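(* Let $d\ge 1$ and let $k$ be an integer with $1\le k\le d$. Then the facets of the polytope $k\rho_{d,k}$ are exactly the polytopes of the form $\mathrm{conv}(\gamma_{d-k}\cup\alpha_{k-1})$, where $\gamma_{d-k}$ is a $(d-k)$-dimensional face of the hypercube $\gamma_d$ and $\alpha_{k-1}$ is the $(k-1)$-dimensional regular simplex whose vertices are the points $k\,c_F$, with $F$ ranging over the $k$ facets of $\gamma_d$ that contain $\gamma_{d-k}$.
   Context: $\gamma_d=[-1,1]^d\subset\mathbb{R}^d$ is the hypercube, and $\beta_d$ is the cross-polytope whose vertices are the centers $\pm e_1,\dots,\pm e_d$ of the facets of $\gamma_d$ (where $e_1,\dots,e_d$ is the standard basis). For $k\in[1,d]$, $\rho_{d,k}=\mathrm{conv}\left(\beta_d\cup\frac{1}{k}\gamma_d\right)$, so that $k\rho_{d,k}=\mathrm{conv}(k\beta_d\cup\gamma_d)$. For a facet $F$ of $\gamma_d$, $c_F$ denotes its center (one of the points $\pm e_j$); the point $k\,c_F$ is called the point pulled from the center of $F$. *)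

(* Defs.v *)
From mathcomp Require Import all_boot all_order all_algebra.
From mathcomp Require Import boolp classical_sets functions cardinality reals convex.

Set Implicit Arguments.
Unset Strict Implicit.
Unset Printing Implicit Defensive.

Import Order.TTheory GRing.Theory Num.Theory.

Local Open Scope classical_set_scope.
Local Open Scope ring_scope.

Section Polytopes.
Variables (R : realType) (d : nat).
Local Notation V := 'rV[R]_d.
Implicit Types (A P F G : set V) (x c : V).

Definition dot (u v : V) : R := \sum_i u 0 i * v 0 i.

(* The library's norm on row vectors is the sup norm. *)
Definition euclid_norm (u : V) : R := Num.sqrt (dot u u).

Definition cvx_hull A : set V := smallest (@convex_set R V) A.

Definition aff_hull A : set V :=
  [set x : V | exists n (w : 'I_n -> R) (p : 'I_n -> V),
     [/\ forall i, A (p i), \sum_i w i = 1 & x = \sum_i w i *: p i]].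

(* The affine hull is a translate of a linear subspace of dimension n;
   the empty set has no dimension. *)
Definition has_dim A (n : nat) : Prop :=
  exists (x : V) (U : {vspace V}),
    aff_hull A = [set x + u | u in [set` U]] /\ \dim U = n.

(* P itself (a = 0, b = 0) and the empty set (a = 0, b = 1) are included. *)
Definition is_face P F : Prop :=
  exists (a : V) (b : R),
    (forall x, P x -> dot a x <= b) /\ F = P `&` [set x : V | dot a x = b].

Definition is_facet P F : Prop :=
  is_face P F /\ exists n, has_dim P n.+1 /\ has_dim F n.

(* Center of symmetry; it is unique when F is bounded and nonempty. *)
Definition is_center F c : Prop := forall x, F x -> F (c *+ 2 - x).

Definition aff_independent n (p : 'I_n -> V) : Prop :=
  forall w : 'I_n -> R,
    \sum_i w i = 0 -> \sum_i w i *: p i = 0 -> forall i, w i = 0.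

Definition is_regular_simplex (n : nat) (vertices A : set V) : Prop :=
  exists p : 'I_n.+1 -> V,
    [/\ aff_independent p,
        exists l, forall i j, i != j -> euclid_norm (p i - p j) = l,
        vertices = range p
      & A = cvx_hull vertices].

Definition dilate (t : R) A : set V := [set t *: x | x in A].

Definition hypercube : set V := [set x : V | forall i, -1 <= x 0 i <= 1].

Definition cross_polytope : set V :=
  cvx_hull [set x : V | exists i, x = delta_mx 0 i \/ x = - delta_mx 0 i].

Definition rho (k : R) : set V :=
  cvx_hull (cross_polytope `|` dilate k^-1 hypercube).

Definition cube_facets_containing G : set (set V) :=
  [set F | is_facet hypercube F /\ G `<=` F].

Definition pulled_points (k : R) G : set V :=
  [set x : V | exists F c,
     [/\ cube_facets_containing G F, is_center F c & x = k *: c]].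

Definition pulled_simplex (k : R) G : set V := cvx_hull (pulled_points k G).

End Polytopes.

Arguments hypercube : clear implicits.
Arguments cross_polytope : clear implicits.
Arguments rho {R} d k.

(* Main.v *)
(* Let [krho] be the dilated polytope. For a vector u with entries in {-1, 0, 1}
   and exactly k nonzero entries, the linear form u is at most k on [krho], and
   it takes the value k precisely on the hull of the cube face {x_i = u_i on the
   support of u} and of the points k u_i e_i; these span the hyperplane.
   Conversely, the outer normal c of a facet, scaled so that the facet lies in
   {c . x = k}, satisfies |c_i| <= 1 and sum |c_i| <= k. The facet spans its
   hyperplane, which determines c, so c is an extreme point of the set of such
   vectors. A slack in the sum can be used to move one coordinate, and two
   coordinates with 0 < |c_i| < 1 can be moved in opposite directions, while a
   single one is excluded because k is an integer. Hence c is one of the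
   vectors u. *)
From HB Require Import structures.
Require Import Defs.
From mathcomp Require Import all_boot all_order all_algebra.
From mathcomp Require Import boolp classical_sets functions cardinality reals convex.
From mathcomp Require Import interval_inference ring lra zify.

Import Order.TTheory GRing.Theory Num.Theory.

Local Open Scope classical_set_scope.
Local Open Scope ring_scope.

Set Implicit Arguments.
Unset Strict Implicit.
Unset Printing Implicit Defensive.

(** * The scalar product as a linear form *)

Section Dot.
Variables (R : realType) (d : nat).
Implicit Types u v x : 'rV[R]_d.

Lemma dotC u v : dot u v = dot v u.
Proof. by apply: eq_bigr => i _; rewrite mulrC. Qed.

Lemma dot_is_linear u : linear (dot u : 'rV[R]_d -> R^o).
Proof.
move=> t x y; rewrite /dot scaler_sumr -big_split/=; apply: eq_bigr => i _.
by rewrite !mxE mulrDr mulrCA.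
Qed.

HB.instance Definition _ u :=
  GRing.isLinear.Build R 'rV[R]_d R^o _ (dot u) (dot_is_linear u).

Lemma dotD u x y : dot u (x + y) = dot u x + dot u y.
Proof. exact: (raddfD (dot u)). Qed.

Lemma dotB u x y : dot u (x - y) = dot u x - dot u y.
Proof. exact: (raddfB (dot u)). Qed.

Lemma dotZ u t x : dot u (t *: x) = t * dot u x.
Proof. exact: (linearZ_LR (dot u : {linear 'rV[R]_d -> R^o}) t x). Qed.

Lemma dot_delta u i : dot u (delta_mx 0 i) = u 0 i.
Proof.
rewrite /dot (bigD1 i)//= mxE !eqxx mulr1 big1 ?addr0// => j /negbTE ji.
by rewrite mxE ji andbF mulr0.
Qed.

Lemma dot_eq0 u : (dot u u == 0) = (u == 0).
Proof.
apply/idP/eqP => [|->]; last by rewrite (raddf0 (dot 0)).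
rewrite /dot psumr_eq0 => [/allP u0|i _]; last by rewrite -expr2 sqr_ge0.
apply/rowP => i; rewrite mxE; apply/eqP.
by have /implyP/(_ isT) := u0 i (mem_index_enum i); rewrite mulf_eq0 orbb.
Qed.

End Dot.

(** * Affine hulls and uniqueness of dimension *)

Section AffineHull.
Variables (R : realType) (d : nat).
Implicit Types (A : set 'rV[R]_d) (x y p q : 'rV[R]_d).

Lemma sub_aff_hull A : A `<=` aff_hull A.
Proof.
move=> x Ax; exists 1%N, (fun=> 1), (fun=> x).
by split => //; rewrite big_ord1 ?scale1r.
Qed.

(** The two families of points are concatenated, with weights scaled by 1 - t and t. *)
Lemma aff_hull_line A x y t :
  aff_hull A x -> aff_hull A y -> aff_hull A (x + t *: (y - x)).
Proof.
move=> [n [w [p [Ap w1 ->]]]] [m [v [q [Aq v1 ->]]]].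
exists (n + m)%N,
  (fun i : 'I_(n + m) => match fintype.split i with inl j => (1 - t) * w j | inr j => t * v j end),
  (fun i : 'I_(n + m) => match fintype.split i with inl j => p j | inr j => q j end).
have splitl j : fintype.split (lshift m j) = inl j :> ('I_n + 'I_m)%type.
  exact: (unsplitK (inl j)).
have splitr j : fintype.split (rshift n j) = inr j :> ('I_n + 'I_m)%type.
  exact: (unsplitK (inr j)).
split; first by move=> i; case: fintype.split.
- rewrite big_split_ord/=.
  under eq_bigr do rewrite splitl.
  under [X in _ + X]eq_bigr do rewrite splitr.
  by rewrite -!mulr_sumr w1 v1 !mulr1 subrK.
- rewrite big_split_ord/=.
  under [in RHS]eq_bigr do rewrite splitl -scalerA.
  under [X in _ = _ + X]eq_bigr do rewrite splitr -scalerA.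
  by rewrite -!scaler_sumr scalerBr scalerBl scale1r addrA addrAC.
Qed.

(** The point is the midpoint of x + 2t (p - x) and x - 2t (q - x), each on a line through two
    points of the hull. *)
Lemma aff_hull_shift A x p q t :
  aff_hull A x -> aff_hull A p -> aff_hull A q ->
  aff_hull A (x + t *: (p - q)).
Proof.
move=> Ax Ap Aq.
have := aff_hull_line (2^-1) (aff_hull_line (t *+ 2) Ax Ap)
                             (aff_hull_line (- t *+ 2) Ax Aq).
congr aff_hull; apply/rowP => i; rewrite !mxE; lra.
Qed.

(** The tool for bounding affine hulls from below: it suffices to write a point as a base point plus
    multiples of differences of points of the hull. *)
Lemma aff_hull_shift_sum (I : finType) (P : {pred I}) A x
    (t : I -> R) (p q : I -> 'rV[R]_d) :
  aff_hull A x -> (forall i, P i -> aff_hull A (p i)) ->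
  (forall i, P i -> aff_hull A (q i)) ->
  aff_hull A (x + \sum_(i | P i) t i *: (p i - q i)).
Proof.
move=> Ax Ap Aq; rewrite addrC.
elim/big_rec : _ => [|i y Pi Ay]; first by rewrite add0r.
by rewrite addrAC -addrA addrC; apply: aff_hull_shift; [rewrite addrC|exact: Ap|exact: Aq].
Qed.

Lemma aff_hull_dot A u b :
  (forall x, A x -> dot u x = b) -> forall x, aff_hull A x -> dot u x = b.
Proof.
move=> Ab _ [n [w [p [Ap w1 ->]]]]; rewrite (raddf_sum (dot u))/=.
under eq_bigr do rewrite dotZ Ab//.
by rewrite -mulr_suml w1 mul1r.
Qed.

(** The direction space is determined by the set: a direction v is the difference of x' + v and x' +
    0, which both lie in the other translate, so v lies in the other space as well. *)
Lemma has_dim_uniq A m n : has_dim A m -> has_dim A n -> m = n.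
Proof.
move=> [x [U [AU <-]]] [y [V [AV <-]]]; congr (\dim _); apply/vspaceP => v.
suff H (x' y' : 'rV[R]_d) (U' V' : {vspace 'rV[R]_d}) :
    aff_hull A = [set x' + u | u in [set` U']] ->
    aff_hull A = [set y' + u | u in [set` V']] -> v \in U' -> v \in V'.
  by apply/idP/idP; apply: H; eassumption.
move=> -> UV vU.
have [u1 u1V e1] : [set y' + u | u in [set` V']] (x' + 0).
  by rewrite -UV; exists 0 => //=; rewrite mem0v.
have [u2 u2V e2] : [set y' + u | u in [set` V']] (x' + v).
  by rewrite -UV; exists v.
have -> : v = u2 - u1.
  by rewrite -[v](addKr x') -e2 -[X in - X]addr0 -e1 opprD addrACA addNr add0r addrC.
by rewrite rpredB.
Qed.

End AffineHull.

(** * Dimensions of coordinate subspaces and hyperplanes *)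

Section Dimension.
Variables (R : realType) (d : nat).

Definition coord_space (T : {pred 'I_d}) : {vspace 'rV[R]_d} :=
  <<[seq delta_mx 0%R i | i <- enum T]>>%VS.

Lemma mem_coord_space T (v : 'rV[R]_d) :
  reflect (forall i, i \notin T -> v 0 i = 0) (v \in coord_space T).
Proof.
apply: (iffP idP) => [vT i iT|v0].
  rewrite (coord_span (X := in_tuple _) vT) summxE big1// => j _.
  have jT : (j < #|T|)%N by rewrite cardE (leq_trans (ltn_ord j))// size_map.
  rewrite mxE (nth_map i) -?cardE// mxE eqxx/=.
  have : nth i (enum T) j \in T by rewrite -mem_enum mem_nth -?cardE.
  by case: eqP => [<-|_ _]; rewrite ?(negPf iT)// mulr0.
rewrite [v]row_sum_delta; apply: memv_suml => i _.
have [iT|iT] := boolP (i \in T); last by rewrite v0// scale0r mem0v.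
by apply/memvZ/memv_span/map_f; rewrite mem_enum.
Qed.

Lemma dim_coord_space T : \dim (coord_space T) = #|T|.
Proof.
rewrite cardE -(size_map (fun i => delta_mx 0 i : 'rV[R]_d)); apply/eqP.
change (free (in_tuple [seq delta_mx 0 i : 'rV[R]_d | i <- enum T])).
apply/freeP => c c0 j.
have jT : (j < size (enum T))%N.
  by rewrite (leq_trans (ltn_ord j))// size_map.
have i0 : 'I_d by have := leq_ltn_trans (leq0n _) jT; case: (enum T).
have /(congr1 (fun v : 'rV[R]_d => v 0 (nth i0 (enum T) j))) := c0.
rewrite summxE (bigD1 j)//= big1 => [|i ij].
  by rewrite !mxE (nth_map i0)// mxE !eqxx mulr1 addr0.
rewrite !mxE (nth_map i0) ?mxE; last by rewrite (leq_trans (ltn_ord i))// size_map.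
rewrite nth_uniq ?enum_uniq//; first last.
  by rewrite (leq_trans (ltn_ord i))// size_map.
by rewrite eq_sym (inj_eq val_inj) (negPf ij) andbF mulr0.
Qed.

(** Rank-nullity: the image of [dot u] lies in a line and is nonzero, because it contains
    [dot u u]. *)
Lemma dim_hyperplane (u : 'rV[R]_d) :
  u != 0 -> \dim (lker (linfun (dot u : 'rV[R]_d -> R^o))) = d.-1.
Proof.
move=> u0; have := limg_ker_dim (linfun (dot u : 'rV[R]_d -> R^o)) fullv.
have -> : \dim (limg (linfun (dot u : 'rV[R]_d -> R^o))) = 1%N.
  apply/eqP; rewrite eqn_leq; apply/andP; split.
    by rewrite (leq_trans (dimvS (subvf _)))// dimvf.
  rewrite lt0n dimv_eq0; apply/eqP => im0.
  have : linfun (dot u : 'rV[R]_d -> R^o) u \in (0%VS : {vspace R^o}).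
    by rewrite -im0 memv_img ?memvf.
  by rewrite memv0 lfunE/= dot_eq0 (negPf u0).
by rewrite capfv dimvf /dim/= mul1n addn1 => /(congr1 predn).
Qed.

Lemma has_dim_hyperplane (A : set 'rV[R]_d) u b : u != 0 ->
  aff_hull A = [set x | dot u x = b] -> A !=set0 -> has_dim A d.-1.
Proof.
move=> u0 AE [x /sub_aff_hull Ax].
exists x, (lker (linfun (dot u : 'rV[R]_d -> R^o))).
split; last exact: dim_hyperplane.
have xb : dot u x = b by rewrite AE in Ax.
rewrite AE; apply/seteqP; split => y /=.
  move=> yb; exists (y - x); rewrite ?subrKC//=.
  by rewrite memv_ker lfunE/= dotB xb yb subrr.
by move=> [v /= + <-]; rewrite memv_ker lfunE/= dotD xb => /eqP ->; rewrite addr0.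
Qed.

Lemma has_dim_full (A : set 'rV[R]_d) :
  aff_hull A = [set: 'rV[R]_d] -> has_dim A d.
Proof.
move=> AE; exists 0, fullv; split; last by rewrite dimvf /dim/= mul1n.
by rewrite AE; apply/seteqP; split => // y _; exists y; rewrite ?add0r//= memvf.
Qed.

(* The hyperplane direction space and the base point [x] span everything, and the
   linear form [u - v] vanishes on both. *)
Lemma hyperplane_normal_uniq (A : set 'rV[R]_d) (u v : 'rV[R]_d) b :
  (0 < d)%N -> has_dim A d.-1 -> b != 0 ->
  (forall x, A x -> dot u x = b) -> (forall x, A x -> dot v x = b) -> u = v.
Proof.
move=> d0 [x [U [AE dimU]]] b0 /aff_hull_dot Au /aff_hull_dot Av.
have Ax y : y \in U -> aff_hull A (x + y) by rewrite AE; exists y.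
have xu : dot u x = b by apply: Au; have := Ax 0 (mem0v _); rewrite addr0.
have xv : dot v x = b by apply: Av; have := Ax 0 (mem0v _); rewrite addr0.
have Uu y : y \in U -> dot u y = 0.
  by move=> /Ax/Au; rewrite dotD xu => /(congr1 (fun z => z - b)); rewrite addrAC subrr add0r.
have Uv y : y \in U -> dot v y = 0.
  by move=> /Ax/Av; rewrite dotD xv => /(congr1 (fun z => z - b)); rewrite addrAC subrr add0r.
have xU : x \notin U by apply: contra b0 => /Uu; rewrite xu => ->.
have full : (U + <[x]>)%VS = fullv.
  apply/eqP; rewrite eqEdim subvf/= dimvf /dim/= mul1n.
  rewrite dimv_disjoint_sum ?dim_vline ?dimU.
    by case: eqP xU => [->|_ _]; rewrite ?mem0v// addn1 prednK.
  apply/eqP; rewrite -subv0; apply/subvP => y; rewrite memv_cap memv0.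
  move=> /andP[yU /vlineP[t yE]]; move: yU; rewrite yE => /Uu/eqP.
  by rewrite dotZ xu mulf_eq0 (negPf b0) orbF => /eqP ->; rewrite scale0r.
apply/eqP; rewrite -subr_eq0 -dot_eq0.
have : u - v \in (U + <[x]>)%VS by rewrite full memvf.
move=> /memv_addP[y yU [z /vlineP[t ->]] uvE].
rewrite [X in dot _ X]uvE dotD dotZ !(dotC (u - v)) !dotB.
by rewrite !(dotC _ u) !(dotC _ v) Uu// Uv// xu xv !subrr mulr0 addr0.
Qed.

End Dimension.

(** * Convex sets and the generators of the dilated polytope *)

Section Convexity.
Variables (R : realType) (d : nat).
Implicit Types (A C : set 'rV[R]_d).

Lemma convex_setP A :
  convex_set A <-> forall x y t, 0 < t -> t < 1 -> A x -> A y ->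
    A (t *: x + (1 - t) *: y).
Proof.
split => [cA x y t t0 t1 Ax Ay|cA].
  have := cA x y (Itv01 (ltW t0) (ltW t1)).
  by rewrite !inE => /(_ Ax Ay).
apply/convex_setW => x y /[!inE] Ax Ay t t0 t1; rewrite inE.
exact: (cA x y t%:num).
Qed.

Lemma sub_cvx_hull A : A `<=` cvx_hull A.
Proof. exact: sub_gen_smallest. Qed.

Lemma cvx_hull_convex A : convex_set (cvx_hull A).
Proof.
apply/convex_setP => x y t t0 t1 Ax Ay C [cC AC].
by apply: (convex_setP C).1 => //; [exact: Ax|exact: Ay].
Qed.

Lemma cvx_hull_sub A C : convex_set C -> A `<=` C -> cvx_hull A `<=` C.
Proof. exact: smallest_sub. Qed.

Lemma convex_preimage_scale C c :
  convex_set C -> convex_set ([set x | C (c *: x)] : set 'rV[R]_d).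
Proof.
move=> /convex_setP cC; apply/convex_setP => x y t t0 t1 Cx Cy /=.
by rewrite scalerDr !scalerA !(mulrC c) -!scalerA; apply: cC.
Qed.

Lemma convex_dilate C c : convex_set C -> convex_set (dilate c C).
Proof.
move=> /convex_setP cC; apply/convex_setP => _ _ t t0 t1 [x Cx <-] [y Cy <-].
exists (t *: x + (1 - t) *: y); first exact: cC.
by rewrite scalerDr !scalerA !(mulrC c).
Qed.

Lemma convex_halfspace u (b : R) : convex_set [set x : 'rV[R]_d | dot u x <= b].
Proof.
apply/convex_setP => x y t t0 t1 /= xb yb; rewrite dotD !dotZ.
have -> : b = t * b + (1 - t) * b by ring.
by rewrite lerD// ler_wpM2l// ?subr_ge0 ltW.
Qed.

(** A combination with both weights positive reaches b only if both of its points do. This reduces a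
    description of the face on which [dot u] equals b to a check on generators of the polytope. *)
Lemma convex_halfspace_boundary u (b : R) C : convex_set C ->
  convex_set [set x : 'rV[R]_d | dot u x <= b /\ (dot u x = b -> C x)].
Proof.
move=> /convex_setP cC; apply/convex_setP => x y t t0 t1 [xb Cx] [yb Cy] /=.
have t'0 : 0 < 1 - t by rewrite subr_gt0.
rewrite dotD !dotZ; split; first by nra.
move=> xyb; apply: cC => //; [apply: Cx|apply: Cy]; nra.
Qed.

Variable k : R.
Hypothesis k0 : k != 0.

Lemma norm1P (s : R) : `|s| = 1 -> s = 1 \/ s = -1.
Proof. by case: (ler0P s) => _ <-; [right; rewrite opprK|left]. Qed.

(** Since k times the scaled cube is the cube, the dilated polytope is generated as a convex set by
    the cube and the points k e_i and -k e_i. Inclusions below are all checked on these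
    generators. *)
Lemma dilate_rho_sub C : convex_set C -> hypercube R d `<=` C ->
  (forall i s, `|s| = 1 -> C ((k * s) *: delta_mx 0 i)) ->
  dilate k (rho d k) `<=` C.
Proof.
move=> cC gC bC; have cC' := convex_preimage_scale (c := k) cC.
suff rC : rho d k `<=` [set x | C (k *: x)] by move=> _ [x /rC Cx <-].
apply: cvx_hull_sub => //; rewrite subUset; split.
  apply: cvx_hull_sub => // _ [i [|]->] /=.
    by have := bC i 1 (normr1 _); rewrite mulr1.
  by have := bC i (-1) (normrN1 _); rewrite mulrN1 scaleNr scalerN.
by move=> _ [y gy <-] /=; rewrite scalerA divff// scale1r; apply: gC.
Qed.

Lemma convex_dilate_rho : convex_set (dilate k (rho d k)).
Proof. exact/convex_dilate/cvx_hull_convex. Qed.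

Lemma hypercube_sub_dilate_rho : hypercube R d `<=` dilate k (rho d k).
Proof.
move=> x gx; exists (k^-1 *: x); last by rewrite scalerA divff// scale1r.
by apply: sub_cvx_hull; right; exists x.
Qed.

Lemma dilate_rho_delta i s :
  `|s| = 1 -> dilate k (rho d k) ((k * s) *: delta_mx 0 i).
Proof.
move=> s1; exists (s *: delta_mx 0 i); last by rewrite scalerA.
apply: sub_cvx_hull; left; apply: sub_cvx_hull; exists i.
by case: (norm1P s1) => ->; rewrite ?scaleN1r ?scale1r; [left|right].
Qed.

End Convexity.

(** * Faces of the cube encoded by sign vectors *)

Section Cube.
Variables (R : realType) (d : nat).
Implicit Types (a u x : 'rV[R]_d) (G : set 'rV[R]_d).

Definition supp u : {pred 'I_d} := [pred i | u 0 i != 0].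

(** The condition [sgv u = u] is used throughout to say that u has entries in {-1, 0, 1}. *)
Definition sgv u : 'rV[R]_d := \row_i Num.sg (u 0 i).

Definition cface u : set 'rV[R]_d :=
  [set x | hypercube R d x /\ forall i, i \in supp u -> x 0 i = Num.sg (u 0 i)].

Lemma hypercube_norm x : hypercube R d x <-> forall i, `|x 0 i| <= 1.
Proof. by split=> gx i; [rewrite ler_norml|rewrite -ler_norml]; exact: gx. Qed.

Lemma mul_coord_le a x i : hypercube R d x -> a 0 i * x 0 i <= `|a 0 i|.
Proof.
move=> /hypercube_norm gx; rewrite (le_trans (ler_norm _))// normrM.
by rewrite ler_piMr.
Qed.

Lemma dot_cube_le a x : hypercube R d x -> dot a x <= \sum_i `|a 0 i|.
Proof. by move=> gx; apply: ler_sum => i _; apply: mul_coord_le. Qed.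

(** The gap between the two sums is a sum of nonnegative terms |a_i| - a_i x_i, so it vanishes only
    if each term does. *)
Lemma dot_cube_eq a x : hypercube R d x ->
  dot a x = \sum_i `|a 0 i| <-> forall i, i \in supp a -> x 0 i = Num.sg (a 0 i).
Proof.
move=> gx; split => [/eqP|xa]; last first.
  apply: eq_bigr => i _; have [a0|a0] := eqVneq (a 0 i) 0.
    by rewrite a0 mul0r normr0.
  by rewrite xa// mulrC -normrEsg.
rewrite eq_sym -subr_eq0 /dot -sumrB psumr_eq0 => [/allP xa i ia|i _]; last first.
  by rewrite subr_ge0 mul_coord_le.
have /implyP/(_ isT) := xa i (mem_index_enum i).
by rewrite normrEsg subr_eq0 mulrC => /eqP/(mulfI ia).
Qed.

Lemma hypercube_sgv u : hypercube R d (sgv u).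
Proof.
by apply/hypercube_norm => i; rewrite mxE normr_sg; case: (_ != 0).
Qed.

Lemma cface_sgv u : cface u (sgv u).
Proof. by split=> [|i _]; [exact: hypercube_sgv|rewrite mxE]. Qed.

Lemma dot_sgv u : dot u (sgv u) = \sum_i `|u 0 i|.
Proof. by apply/dot_cube_eq => [|i _]; [exact: hypercube_sgv|rewrite mxE]. Qed.

Lemma supp_sgv u : supp (sgv u) =i supp u.
Proof. by move=> i; rewrite !inE mxE sgr_eq0. Qed.

Lemma sgv_id u : sgv (sgv u) = sgv u.
Proof. by apply/rowP => i; rewrite !mxE sgr_id. Qed.

Lemma cfaceE u :
  cface u = hypercube R d `&` [set x | dot u x = \sum_i `|u 0 i|].
Proof. by apply/seteqP; split => x [gx /dot_cube_eq ux]; split => //; apply: ux. Qed.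

Lemma is_face_cface u : is_face (hypercube R d) (cface u).
Proof.
exists u, (\sum_i `|u 0 i|); split; last exact: cfaceE.
by move=> x; apply: dot_cube_le.
Qed.

(** A nonempty face is where its form attains its maximum on the cube, and by [dot_cube_eq] this
    locus depends only on the signs of the coefficients. *)
Lemma is_face_cubeP G : is_face (hypercube R d) G -> G !=set0 ->
  exists u, sgv u = u /\ G = cface u.
Proof.
move=> [a [b [ab ->]]] [x [gx xb]]; exists (sgv a); split; first exact: sgv_id.
have -> : cface (sgv a) = cface a.
  apply/seteqP; split => y [gy ya]; split => // i; move: (ya i);
  by rewrite supp_sgv mxE sgr_id.
(* The bound b is at least the maximum, by validity at [sgv a], and at most the maximum, because x
   attains it. *)
rewrite cfaceE; suff -> : b = \sum_i `|a 0 i| by [].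
apply/eqP; rewrite eq_le -dot_sgv (ab _ (hypercube_sgv a)) andbT.
by rewrite -xb dot_sgv dot_cube_le.
Qed.

Lemma cface_shift u i : i \notin supp u -> cface u (sgv u + delta_mx 0 i).
Proof.
move=> iu; split.
  apply/hypercube_norm => j; rewrite !mxE eqxx/=; case: eqP => [->|_].
    by move: iu; rewrite inE negbK => /eqP ->; rewrite sgr0 add0r normr1.
  by rewrite addr0 normr_sg; case: (_ != 0).
move=> j ju; rewrite !mxE eqxx/=; case: eqP => [ji|_]; last by rewrite addr0.
by rewrite -ji ju in iu.
Qed.

(** Coordinates in the support are constant on the face, hence on its affine hull; each other
    coordinate can be moved from [sgv u] by a unit vector inside the face. *)
Lemma has_dim_cface u : has_dim (cface u) (d - #|supp u|).
Proof.
exists (sgv u), (coord_space R [predC supp u]); split; last first.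
  by rewrite dim_coord_space -[X in (X - _)%N](card_ord d) -(cardC (supp u)) addKn.
apply/seteqP; split => y /=.
  move=> uy; exists (y - sgv u); last by rewrite addrC subrK.
  apply/mem_coord_space => i; rewrite inE/= negbK => iu.
  rewrite !mxE -(dot_delta y i) dotC (aff_hull_dot (b := Num.sg (u 0 i)) _ uy) ?subrr//.
  move=> x [_ xu].
  by rewrite dotC dot_delta xu.
move=> [v /mem_coord_space vu <-].
have -> : v = \sum_(i | i \notin supp u) v 0 i *: (sgv u + delta_mx 0 i - sgv u).
  rewrite [LHS]row_sum_delta (bigID (mem (supp u)))/= big1 => [|i iu].
    by rewrite add0r; apply: eq_bigr => i _; rewrite addrAC subrr add0r.
  by rewrite vu ?scale0r// inE/= negbK.
have uu := sub_aff_hull (cface_sgv u).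
apply: aff_hull_shift_sum => // i iu; exact/sub_aff_hull/cface_shift.
Qed.

(** The translate contains x, and an affine combination of no points has total weight 0, not 1. *)
Lemma has_dim_nonempty G n : has_dim G n -> G !=set0.
Proof.
move=> [x [U [GU _]]]; apply/set0P/eqP => G0.
have : aff_hull G x by rewrite GU; exists 0; rewrite ?addr0//= mem0v.
move=> [[|m] [w [p [Gp + _]]]].
  by rewrite big_ord0 => /eqP; rewrite eq_sym oner_eq0.
by have := Gp ord0; rewrite G0.
Qed.

Lemma card_supp_le u : (#|supp u| <= d)%N.
Proof. by rewrite -[leqRHS]card_ord max_card. Qed.

Lemma cube_faceP G m : (m <= d)%N ->
  (is_face (hypercube R d) G /\ has_dim G (d - m)) <->
  exists u, [/\ sgv u = u, #|supp u| = m & G = cface u].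
Proof.
move=> md; split => [[fG dG]|[u [uu um ->]]]; last first.
  by rewrite -um; split; [exact: is_face_cface|exact: has_dim_cface].
have [u [uu GE]] := is_face_cubeP fG (has_dim_nonempty dG).
exists u; split => //; move: dG; rewrite GE => /(has_dim_uniq (has_dim_cface u)).
(* Both m and the size of the support are at most d, so the truncated subtractions from d can be
   cancelled. *)
by have := card_supp_le u; lia.
Qed.

End Cube.

(** * Facets of the cube, their centers and the pulled simplex *)

Section CubeFacets.
Variables (R : realType) (d : nat).
Implicit Types (u c x : 'rV[R]_d) (P F : set 'rV[R]_d).
Hypothesis d0 : (0 < d)%N.

Lemma is_facet_full P F :
  has_dim P d -> is_facet P F <-> is_face P F /\ has_dim F d.-1.
Proof.
move=> Pd; split=> [[fF [n [Pn Fn]]]|[fF Fd]]; split => //.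
  by have -> : d.-1 = n by rewrite -[n]/n.+1.-1 (has_dim_uniq Pn Pd).
by exists d.-1; rewrite prednK.
Qed.

(** The cube is the face of the zero vector, which fixes no coordinate. *)
Lemma has_dim_hypercube : has_dim (hypercube R d) d.
Proof.
have supp0 : supp (0 : 'rV[R]_d) =i pred0 by move=> i; rewrite !inE mxE eqxx.
have := has_dim_cface (0 : 'rV[R]_d); rewrite (eq_card0 supp0) subn0.
congr has_dim; apply/seteqP; split=> [x []//|x gx]; split => // i.
by rewrite supp0.
Qed.

Lemma norm_sgv_id u i : sgv u = u -> i \in supp u -> `|u 0 i| = 1.
Proof. by move=> <-; rewrite supp_sgv mxE normr_sg inE => ->. Qed.

Lemma sg_norm1 (s : R) : `|s| = 1 -> Num.sg s = s.
Proof. by case/norm1P => ->; rewrite ?sgrN1 ?sgr1. Qed.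

Lemma supp_scale_delta (s : R) i :
  s != 0 -> supp (s *: delta_mx 0 i : 'rV[R]_d) =i pred1 i.
Proof.
move=> s0 j; rewrite !inE !mxE eqxx/=.
by case: (j == i); rewrite ?mulr1 ?mulr0 ?eqxx.
Qed.

(** Facets correspond to sign vectors with a single nonzero entry. *)
Lemma cube_facetP F : is_facet (hypercube R d) F <->
  exists i s, `|s| = 1 /\ F = cface (s *: delta_mx 0 i).
Proof.
rewrite (is_facet_full _ has_dim_hypercube) -subn1 (cube_faceP _ d0).
split=> [[u [uu /mem_card1[i ui] ->]]|[i [s [s1 ->]]]].
  have iu : i \in supp u by rewrite ui inE.
  exists i, (u 0 i); split; first exact: norm_sgv_id.
  congr cface; apply/rowP => j; rewrite !mxE eqxx/=; case: eqP => [->|/eqP ji].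
    by rewrite mulr1.
  by rewrite mulr0; apply/eqP; have := ui j; rewrite !inE (negPf ji) => /negPn.
have s0 : s != 0 by rewrite -normr_gt0 s1.
exists (s *: delta_mx 0 i); split => //; last first.
  by rewrite (eq_card (supp_scale_delta i s0)) card1.
apply/rowP => j; rewrite !mxE eqxx/=; case: eqP => _.
  by rewrite mulr1 sg_norm1.
by rewrite mulr0 sgr0.
Qed.

Lemma cface_scale_delta (s : R) i : `|s| = 1 ->
  cface (s *: delta_mx 0 i) = hypercube R d `&` [set x | x 0 i = s].
Proof.
move=> s1; have s0 : s != 0 by rewrite -normr_gt0 s1.
apply/seteqP; split=> x [gx xs]; split => //=.
  by rewrite xs ?supp_scale_delta ?inE// !mxE !eqxx mulr1 sg_norm1.
by move=> j; rewrite supp_scale_delta// inE => /eqP ->; rewrite !mxE !eqxx mulr1 sg_norm1.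
Qed.

Lemma is_center_cube_facet (s : R) i c : `|s| = 1 ->
  is_center (cface (s *: delta_mx 0 i)) c <-> c = s *: delta_mx 0 i.
Proof.
move=> s1; rewrite cface_scale_delta//; split=> [cc|-> x [/hypercube_norm gx xi]].
  (* Reflecting [y 1] and [y (-1)] in c and staying in the cube gives c_j >= 0 and c_j <= 0 for j
     different from i; the coordinate i of a reflected point gives c_i = s. *)
  pose y (t : R) : 'rV[R]_d := \row_j if j == i then s else t.
  have yF t : `|t| = 1 -> (hypercube R d `&` [set x | x 0 i = s]) (y t).
    move=> t1; split; last by rewrite /= mxE eqxx.
    by apply/hypercube_norm => j; rewrite mxE; case: eqP => _; rewrite ?s1 ?t1.
  have [g1 e1] := cc _ (yF 1 (normr1 _)).
  have [g2 _] := cc _ (yF (-1) (normrN1 _)).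
  apply/rowP => j; have := g1 j; have := g2 j; move: e1 => /=.
  rewrite !mxE !eqxx/=; by case: eqP => [->|_]; rewrite /= ?(mulr1, mulr0) => e1 /andP[? ?] /andP[? ?]; lra.
split => /=; last by rewrite !mxE xi !eqxx /= mulr1; lra.
apply/hypercube_norm => j; rewrite !mxE eqxx/=; case: eqP => [->|_].
  by rewrite xi mulr1 addrK s1.
by rewrite mulr0 addr0 sub0r normrN.
Qed.

Lemma cube_facets_containing_cface u F : sgv u = u ->
  cube_facets_containing (cface u) F <->
  exists2 i, i \in supp u & F = cface (u 0 i *: delta_mx 0 i).
Proof.
move=> uu; split=> [[/cube_facetP[i [s [s1 ->]]] uF]|[i iu ->]].
  (* The sign vector u is itself a point of its face, so a facet x_i = s containing the face has s =
     u_i. *)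
  have [_ /= ui] : (hypercube R d `&` [set x | x 0 i = s]) u.
    by rewrite -cface_scale_delta//; apply: uF; rewrite -{2}uu; exact: cface_sgv.
  by exists i; rewrite ?inE ui// -normr_gt0 s1.
have ui := norm_sgv_id uu iu.
split; first by apply/cube_facetP; exists i, (u 0 i).
by rewrite cface_scale_delta// => x [gx xu]; split => //=; rewrite xu// sg_norm1.
Qed.

Lemma pulled_points_cface u k : sgv u = u ->
  pulled_points k (cface u) =
  [set (k * u 0 i) *: delta_mx 0 i | i in [set i | i \in supp u]].
Proof.
move=> uu; apply/seteqP; split=> x.
  move=> [F [c [/(cube_facets_containing_cface _ uu)[i iu ->] + ->]]].
  move=> /(is_center_cube_facet _ _ (norm_sgv_id uu iu)) ->.
  by exists i; rewrite ?scalerA.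
move=> [i /= iu <-]; exists (cface (u 0 i *: delta_mx 0 i)), (u 0 i *: delta_mx 0 i).
split; last by rewrite scalerA.
  by apply/cube_facets_containing_cface => //; exists i.
by apply/is_center_cube_facet => //; exact: norm_sgv_id.
Qed.

Lemma card_cube_facets_containing u : sgv u = u ->
  (cube_facets_containing (cface u) #= `I_#|supp u|)%card.
Proof.
(* The map e enumerates the support; the default [i0] is never returned at indices below the size of
   the support. *)
move=> uu; have i0 : 'I_d := Ordinal d0; pose e := nth i0 (enum (supp u)).
have eu n : (n < #|supp u|)%N -> e n \in supp u.
  by move=> nk; rewrite -mem_enum mem_nth// -cardE.
have -> : cube_facets_containing (cface u) =
    [set cface (u 0 (e n) *: delta_mx 0 (e n)) | n in `I_#|supp u|].
  apply/seteqP; split=> F.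
    move=> /(cube_facets_containing_cface _ uu)[i iu ->].
    have iu' : i \in enum (supp u) by rewrite mem_enum.
    by exists (index i (enum (supp u))); rewrite /= ?cardE ?index_mem// /e nth_index.
  move=> [n /= nk <-]; apply/cube_facets_containing_cface => //.
  by exists (e n) => //; exact: eu.
apply: inj_card_eq => m n /[!inE] /= mk nk.
rewrite !cface_scale_delta ?(norm_sgv_id uu) ?eu// => mn.
(* Injectivity: the center of the facet numbered m lies on the one numbered n, whereas its
   coordinate [e n] would be 0 if [e m] and [e n] differed. *)
have [_ /=] : (hypercube R d `&` [set x | x 0 (e n) = u 0 (e n)])
    (u 0 (e m) *: delta_mx 0 (e m)).
  rewrite -mn -cface_scale_delta ?(norm_sgv_id uu) ?eu//.
  split=> [|i]; last first.
    by rewrite supp_scale_delta -?normr_gt0 ?(norm_sgv_id uu) ?eu// => /eqP ->;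
      rewrite !mxE !eqxx mulr1 sg_norm1// (norm_sgv_id uu) ?eu.
  apply/hypercube_norm => i; rewrite !mxE eqxx/=; case: eqP => _.
    by rewrite mulr1 (norm_sgv_id uu) ?eu.
  by rewrite mulr0 normr0.
rewrite !mxE eqxx/=; case: eqP => [/eqP|_].
  by rewrite nth_uniq ?enum_uniq -?cardE// => /eqP.
by rewrite mulr0 => /esym/eqP; have := eu n nk; rewrite inE => /negPf ->.
Qed.

(** The vertices are nonzero multiples of distinct basis vectors, hence independent, and any two of
    them are at squared distance 2 k^2. *)
Lemma pulled_simplex_regular u (k : R) : sgv u = u -> k != 0 ->
  (0 < #|supp u|)%N ->
  is_regular_simplex (#|supp u| - 1)
    (pulled_points k (cface u)) (pulled_simplex k (cface u)).
Proof.
move=> uu k0 u0; have i0 : 'I_d := Ordinal d0; pose e := nth i0 (enum (supp u)).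
have nk (n : 'I_(#|supp u| - 1).+1) : (n < #|supp u|)%N.
  by rewrite (leq_trans (ltn_ord n))// subn1 prednK.
have eu (n : 'I_(#|supp u| - 1).+1) : e n \in supp u.
  by rewrite -mem_enum mem_nth// -cardE.
have e_inj (m n : 'I_(#|supp u| - 1).+1) : (e n == e m) = (n == m).
  by rewrite nth_uniq ?enum_uniq -?cardE.
exists (fun n => (k * u 0 (e n)) *: delta_mx 0 (e n)); split => //.
- move=> w _ /rowP w0 n; have := w0 (e n).
  rewrite summxE (bigD1 n)//= big1 => [|m mn].
    rewrite addr0 !mxE !eqxx mulr1 => /eqP; rewrite !mulf_eq0 (negPf k0)/=.
    by rewrite (negPf (eu n)) orbF => /eqP.
  by rewrite !mxE e_inj eq_sym (negPf mn) andbF !mulr0.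
- exists (Num.sqrt (k ^+ 2 *+ 2)) => m n mn; congr Num.sqrt.
  have sq i : i \in supp u -> u 0 i ^+ 2 = 1.
    by move=> iu; rewrite -real_normK ?num_real// (norm_sgv_id uu)// expr1n.
  rewrite dotB !(dotC (_ - _)) !dotB !dotZ !dot_delta !mxE !eqxx !e_inj.
  rewrite /= [n == m]eq_sym (negPf mn) /= !mulr0 !mulr1 subr0 sub0r opprK.
  have := sq _ (eu m); have := sq _ (eu n); move=> en em.
  by rewrite -!expr2 !exprMn en em !mulr1.
- rewrite pulled_points_cface//; apply/seteqP; split=> x.
    move=> [i /= iu <-].
    have iu' : i \in enum (supp u) by rewrite mem_enum.
    have ik : (index i (enum (supp u)) < (#|supp u| - 1).+1)%N.
      by rewrite subn1 prednK// cardE index_mem.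
    by exists (Ordinal ik) => //; rewrite /e nth_index.
  by move=> [n _ <-]; exists (e n) => //; exact: eu.
Qed.

End CubeFacets.

(** * Pulled facets as facets of the dilated polytope *)

Section PulledFacets.
Variables (R : realType) (d k : nat).
Hypotheses (d0 : (0 < d)%N) (k_gt0 : (0 < k)%N) (k_le_d : (k <= d)%N).
Implicit Types (a c e u x : 'rV[R]_d) (P F : set 'rV[R]_d).

Local Notation krho := (dilate k%:R (rho d (k%:R : R))).

Let kR_gt0 : (0 : R) < k%:R. Proof. by rewrite ltr0n. Qed.

Let kR_neq0 : (k%:R : R) != 0. Proof. exact: lt0r_neq0. Qed.

Definition pulled_facet u : set 'rV[R]_d :=
  cvx_hull (cface u `|` pulled_simplex k%:R (cface u)).

(** On the generators the form is at most the sum of the |c_i| (cube) or k |c_i| (pulled points),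
    and both are at most k. *)
Lemma dot_dilate_rho_le c x : (forall i, `|c 0 i| <= 1) ->
  \sum_i `|c 0 i| <= k%:R -> krho x -> dot c x <= k%:R.
Proof.
move=> c1 ck; suff /(_ x) : krho `<=` [set x | dot c x <= k%:R] by [].
apply: dilate_rho_sub => // [|y gy|i s s1]; first exact: convex_halfspace.
  exact: le_trans (dot_cube_le _ gy) ck.
rewrite /= dotZ dot_delta -mulrA ler_piMr ?(ltW kR_gt0)// (le_trans (ler_norm _))//.
by rewrite normrM s1 mul1r.
Qed.

Lemma sum_norm_sgv u : sgv u = u -> \sum_i `|u 0 i| = #|supp u|%:R.
Proof.
move=> uu; rewrite (bigID (mem (supp u)))/= [X in _ + X]big1 => [|i]; last first.
  by rewrite inE negbK => /eqP ->; rewrite normr0.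
rewrite addr0 -sum1_card natr_sum.
by apply: eq_bigr => i iu; rewrite (norm_sgv_id uu).
Qed.

Lemma norm_sgv_le1 u i : sgv u = u -> `|u 0 i| <= 1.
Proof. by move=> <-; rewrite mxE normr_sg; case: (_ != 0). Qed.

Lemma mul_sgv_id u i : sgv u = u -> i \in supp u -> u 0 i * u 0 i = 1.
Proof.
by move=> uu iu; rewrite -expr2 -real_normK ?num_real// (norm_sgv_id uu)// expr1n.
Qed.

(** The form of u has maximum k on the cube, attained on [cface u], and takes the value k at a point
    k s e_i with |s| = 1 exactly when s = u_i. *)
Lemma pulled_facetE u : sgv u = u -> #|supp u| = k ->
  pulled_facet u = krho `&` [set x | dot u x = k%:R].
Proof.
move=> uu uk; have us : \sum_i `|u 0 i| = k%:R by rewrite sum_norm_sgv// uk.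
apply/seteqP; split.
  have convex_facet : convex_set (krho `&` [set x | dot u x = k%:R]).
    apply/convex_setP => x y t t0 t1 [rx xk] [ry yk]; split.
      exact: ((convex_setP _).1 (@convex_dilate_rho _ d k%:R)).
    by rewrite /= dotD !dotZ xk yk -mulrDl subrKC mul1r.
  apply: cvx_hull_sub => //.
  rewrite subUset; split.
    move=> x [gx xu]; split; first exact: hypercube_sub_dilate_rho.
    by rewrite -us; apply/dot_cube_eq.
  apply: cvx_hull_sub => //.
  rewrite pulled_points_cface// => _ [i /= iu <-]; split => /=.
    by apply: dilate_rho_delta => //; exact: norm_sgv_id.
  by rewrite dotZ dot_delta -mulrA mul_sgv_id// mulr1.
(* The right-hand side is convex and contains the generators of [krho]. *)
suff : krho `<=` [set x | dot u x <= k%:R /\ (dot u x = k%:R -> pulled_facet u x)].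
  by move=> H x [/H[_ Hx] /Hx].
apply: dilate_rho_sub => //.
- exact/convex_halfspace_boundary/cvx_hull_convex.
- move=> x gx; rewrite /= -us; split; first exact: dot_cube_le.
  by move=> /dot_cube_eq ux; apply: sub_cvx_hull; left; split => //; exact: ux.
- move=> i s s1 /=.
  rewrite dotZ dot_delta -mulrA.
  have su : s * u 0 i <= 1.
    by rewrite (le_trans (ler_norm _))// normrM s1 mul1r norm_sgv_le1.
  split; first by rewrite ler_piMr ?(ltW kR_gt0).
  (* Equality forces s u_i = 1, so i is in the support and s = u_i: the generator is a pulled
     point. *)
  rewrite -[X in _ = X]mulr1 => /(mulfI kR_neq0) su1.
  have iu : i \in supp u.
    by rewrite inE; apply/eqP => u0; move/eqP: su1; rewrite u0 mulr0 eq_sym oner_eq0.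
  apply: sub_cvx_hull; right; apply: sub_cvx_hull.
  rewrite pulled_points_cface//; exists i => //; congr (_ * _ *: _).
  by rewrite -[LHS]mul1r -su1 -mulrA mul_sgv_id// mulr1.
Qed.

(** The polytope contains the cube, hence the origin and the unit vectors, which affinely span the
    space. *)
Lemma has_dim_dilate_rho : has_dim krho d.
Proof.
apply: has_dim_full; apply/seteqP; split=> // y _.
have cube_krho x : (forall i, `|x 0 i| <= 1) -> aff_hull krho x.
  by move=> x1; apply/sub_aff_hull/hypercube_sub_dilate_rho => //; exact/hypercube_norm.
have -> : y = 0 + \sum_i y 0 i *: (delta_mx 0 i - 0).
  by rewrite add0r [LHS]row_sum_delta; apply: eq_bigr => i _; rewrite subr0.
apply: aff_hull_shift_sum => [|i _|i _]; apply: cube_krho => j.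
- by rewrite mxE normr0.
- by rewrite mxE eqxx/=; case: (j == i); rewrite ?normr1 ?normr0.
- by rewrite mxE normr0.
Qed.

(** The affine hull is the whole hyperplane on which [dot u] equals k: each of its points is reached
    from u along differences of points of the facet. *)
Lemma has_dim_pulled_facet u : sgv u = u -> #|supp u| = k ->
  has_dim (pulled_facet u) d.-1.
Proof.
move=> uu uk; have FE := pulled_facetE uu uk.
have cF : cface u `<=` pulled_facet u by move=> x ux; apply: sub_cvx_hull; left.
have Fu : pulled_facet u u by apply: cF; rewrite -{2}uu; exact: cface_sgv.
apply: (@has_dim_hyperplane _ _ _ u k%:R); last by exists u.
  by rewrite -dot_eq0; move: Fu; rewrite FE => -[_ /= ->].
apply/seteqP; split; first by apply: aff_hull_dot => x; rewrite FE => -[].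
move=> y /= yk.
(* The coefficients are chosen so that t_i (p_i - u) = y_i e_i - (u_i y_i / k) u in both cases; the
   sum over i is y - (u . y / k) u, which is y - u on the hyperplane. *)
pose p i := if i \in supp u then (k%:R * u 0 i) *: delta_mx 0 i
            else u + delta_mx 0 i : 'rV[R]_d.
pose t i := if i \in supp u then u 0 i * y 0 i / k%:R else y 0 i.
have -> : y = u + \sum_i t i *: (p i - u).
  have tE i : t i *: (p i - u) = y 0 i *: delta_mx 0 i - (u 0 i * y 0 i / k%:R) *: u.
    rewrite /t /p; case: ifPn => iu.
      rewrite scalerBr scalerA; congr (_ *: _ - _).
      by rewrite mulrA divfK// mulrAC mul_sgv_id// mul1r.
    move: iu; rewrite inE negbK => /eqP ->.
    by rewrite !mul0r scale0r subr0 addrAC subrr add0r.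
  under eq_bigr do rewrite tE.
  rewrite sumrB -scaler_suml -mulr_suml -row_sum_delta -/(dot u y) yk.
  by rewrite divff// scale1r subrKC.
apply: aff_hull_shift_sum => [|i _|i _]; apply: sub_aff_hull => //.
rewrite /p; case: ifPn => iu.
  rewrite FE; split => /=; last by rewrite dotZ dot_delta -mulrA mul_sgv_id// mulr1.
  by apply: dilate_rho_delta => //; exact: norm_sgv_id.
by apply: cF; rewrite -{2}uu; exact: cface_shift.
Qed.

Lemma is_facet_pulled_facet u : sgv u = u -> #|supp u| = k ->
  is_facet krho (pulled_facet u).
Proof.
move=> uu uk; apply/(is_facet_full d0 _ has_dim_dilate_rho); split; last first.
  exact: has_dim_pulled_facet.
exists u, k%:R; split; last exact: pulled_facetE.
move=> x; apply: dot_dilate_rho_le => [i|]; first exact: norm_sgv_le1.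
by rewrite sum_norm_sgv// uk.
Qed.

(* [c] is an extreme point of [Q = {c | `|c i| <= 1, \sum_i `|c i| <= k}],
   which is, up to the factor [k], the polar of [krho]. *)
Definition extreme_normal c :=
  forall e, (forall s : R, `|s| = 1 -> (forall i, `|c 0 i + s * e 0 i| <= 1) /\
                             \sum_i `|c 0 i + s * e 0 i| <= k%:R) -> e = 0.

(** * Extreme normals are sign vectors with k nonzero entries *)

Section Extreme.
Variable c : 'rV[R]_d.
Hypotheses (c1 : forall i, `|c 0 i| <= 1) (ck : \sum_i `|c 0 i| <= k%:R).
Hypothesis c_ext : extreme_normal c.

Lemma extreme_normal_sum : \sum_i `|c 0 i| = k%:R.
Proof.
apply/eqP; rewrite eq_le ck/= leNgt; apply/negP => ltk.
(* Otherwise every |c_i| is 1 and the sum is d, which is at least k. *)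
have [j cj] : exists j, `|c 0 j| < 1.
  apply/existsP; rewrite -[X in is_true X]negbK negb_exists; apply/negP => /forallP c1'.
  move: ltk; rewrite (eq_bigr (fun=> 1)) => [|i _]; last first.
    by apply/eqP; rewrite eq_le c1/= leNgt c1'.
  by rewrite sumr_const card_ord ltr_nat ltnNge k_le_d.
(* The smaller of the two slacks, so that moving coordinate j by [eps] either way violates neither
   constraint. *)
pose eps := Num.min (1 - `|c 0 j|) (k%:R - \sum_i `|c 0 i|).
have eps0 : 0 < eps by rewrite lt_min !subr_gt0 cj.
have eps1 : eps <= 1 - `|c 0 j| by rewrite ge_min lexx.
have eps2 : eps <= k%:R - \sum_i `|c 0 i| by rewrite ge_min lexx orbT.
suff /c_ext/rowP/(_ j) : forall s : R, `|s| = 1 ->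
    (forall i, `|c 0 i + s * (eps *: delta_mx 0 j : 'rV[R]_d) 0 i| <= 1) /\
    \sum_i `|c 0 i + s * (eps *: delta_mx 0 j : 'rV[R]_d) 0 i| <= k%:R.
  by rewrite !mxE !eqxx mulr1 => eps_0; rewrite eps_0 ltxx in eps0.
move=> s s1.
have cE i : `|c 0 i + s * (eps *: delta_mx 0 j : 'rV[R]_d) 0 i| <=
    `|c 0 i| + (if i == j then eps else 0).
  rewrite (le_trans (ler_normD _ _))// lerD2l normrM s1 mul1r !mxE eqxx/=.
  by case: (i == j); rewrite ?mulr1 ?mulr0 ?normr0// ger0_norm// ltW.
split=> [i|].
  apply: le_trans (cE i) _; case: eqP => [->|_]; last by rewrite addr0.
  by rewrite -lerBrDl.
apply: le_trans (ler_sum _ (fun i _ => cE i)) _.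
by rewrite big_split/= -big_mkcond/= big_pred1_eq -lerBrDl.
Qed.

(* Move [c] along its own signs, so that the absolute values change by [f]. *)
Lemma extreme_normal_move (f : 'I_d -> R) : \sum_i f i = 0 ->
  (forall i, `|f i| <= `|c 0 i| /\ `|f i| <= 1 - `|c 0 i|) -> forall i, f i = 0.
Proof.
move=> f0 fc i.
(* The bound |f_j| <= |c_j| prevents a change of sign; where c_j = 0 it forces f_j = 0. *)
have cE (s : R) j : `|s| = 1 ->
    `|c 0 j + s * (\row_j (f j * Num.sg (c 0 j)) : 'rV[R]_d) 0 j| = `|c 0 j| + s * f j.
  move=> s1; have [fj _] := fc j; rewrite mxE mulrA {1}[c 0 j]numEsg.
  have [cj0|cj0] := eqVneq (c 0 j) 0.
    move: fj; rewrite cj0 normr0 normr_le0 => /eqP ->.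
    by rewrite !(mulr0, mul0r, addr0) normr0.
  rewrite mulrC -mulrDl normrM normr_sg cj0 mulr1 ger0_norm// -lerBlDl sub0r.
  by rewrite lerNl (le_trans _ fj)// -[leRHS]mul1r -s1 -normrM -normrN ler_norm.
have /c_ext/rowP/(_ i) : forall s : R, `|s| = 1 ->
    (forall j, `|c 0 j + s * (\row_j (f j * Num.sg (c 0 j)) : 'rV[R]_d) 0 j| <= 1) /\
    \sum_j `|c 0 j + s * (\row_j (f j * Num.sg (c 0 j)) : 'rV[R]_d) 0 j| <= k%:R.
  move=> s s1; split=> [j|].
    rewrite cE// addrC -lerBrDr; have [_] := fc j; apply: le_trans.
    by rewrite -[leRHS]mul1r -s1 -normrM ler_norm.
  under eq_bigr do rewrite cE//.
  by rewrite big_split/= -mulr_sumr f0 mulr0 addr0.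
rewrite !mxE => /eqP; rewrite mulf_eq0 sgr_eq0 => /orP[/eqP//|/eqP ci].
by have [+ _] := fc i; rewrite ci normr0 normr_le0 => /eqP.
Qed.

(** Suppose |c_j| is strictly between 0 and 1. A second such coordinate allows a trade with j that
    keeps the sum; without one, the sum would not be an integer. *)
Lemma extreme_normal_norm j : `|c 0 j| = 0 \/ `|c 0 j| = 1.
Proof.
apply: contrapT => /not_orP[cj0 cj1].
have {cj0} cj0 : 0 < `|c 0 j| by rewrite lt0r normr_ge0 andbT; apply/eqP.
have {cj1} cj1 : `|c 0 j| < 1 by rewrite lt_neqAle c1 andbT; apply/eqP.
have [[l [lj cl0 cl1]]|no_l] :=
    pselect (exists l, [/\ l != j, 0 < `|c 0 l| & `|c 0 l| < 1]).
  (* The least distance of |c_j| and |c_l| from 0 and 1, which meets both bounds of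
     [extreme_normal_move]. *)
  pose eps := Num.min (Num.min `|c 0 j| (1 - `|c 0 j|))
                      (Num.min `|c 0 l| (1 - `|c 0 l|)).
  have eps0 : 0 < eps by rewrite !lt_min !subr_gt0 cj0 cj1 cl0 cl1.
  have := extreme_normal_move
    (f := fun i => if i == j then eps else if i == l then - eps else 0).
  move=> /(_ _ _ j); rewrite eqxx => H.
  suff eps_0 : eps = 0 by rewrite eps_0 ltxx in eps0.
  apply: H.
    rewrite (bigD1 j)//= eqxx (bigD1 l)//= (negPf lj) eqxx big1 => [|i /andP[ij il]].
      by rewrite addr0 subrr.
    by rewrite (negPf ij) (negPf il).
  move=> i; case: (eqVneq i j) => [->|ij].
    by rewrite gtr0_norm// !ge_min !lexx ?orbT.
  case: (eqVneq i l) => [->|il].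
    by rewrite normrN gtr0_norm// !ge_min !lexx ?orbT.
  by rewrite normr0 subr_ge0.
(* All other absolute values are 0 or 1, so they sum to an integer m; then m < k < m + 1, which is
   absurd. *)
have [m cm] : exists m : nat, \sum_(i | i != j) `|c 0 i| = m%:R.
  exists #|[pred i | (i != j) && (i \in supp c)]|.
  rewrite (bigID (mem (supp c)))/= [X in _ + X]big1 => [|i]; last first.
    by rewrite inE negbK => /andP[_ /eqP ->]; rewrite normr0.
  rewrite addr0 -sum1_card natr_sum; apply: eq_bigr => i /andP[ij ic].
  apply/eqP; rewrite eq_le c1/= leNgt; apply/negP => ci1; apply: no_l.
  by exists i; split => //; rewrite normr_gt0.
have := extreme_normal_sum; rewrite (bigD1 j)//= cm => mk.
have mk1 : (m%:R : R) < k%:R by lra.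
have mk2 : (k%:R : R) < m.+1%:R by rewrite -natr1; lra.
by move: mk1 mk2; rewrite !ltr_nat; lia.
Qed.

Lemma extreme_normal_sgv : sgv c = c.
Proof.
apply/rowP => i; rewrite mxE.
have [/eqP|] := extreme_normal_norm i; last exact: sg_norm1.
by rewrite normr_eq0 => /eqP ->; rewrite sgr0.
Qed.

Lemma card_supp_extreme_normal : #|supp c| = k.
Proof.
apply/eqP; rewrite -(eqr_nat R) -extreme_normal_sum.
by rewrite sum_norm_sgv//; exact: extreme_normal_sgv.
Qed.

End Extreme.

(** The sign vector is the outer normal of the facet, rescaled so that its level is k; uniqueness of
    this normal makes it extreme. *)
Lemma facet_dilate_rhoP P : is_facet krho P ->
  exists u, [/\ sgv u = u, #|supp u| = k & P = pulled_facet u].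
Proof.
move=> /(is_facet_full d0 _ has_dim_dilate_rho)[[a [b [ab PE]]] Pd].
have ak i : k%:R * `|a 0 i| <= b.
  have [a0|a0] := eqVneq (a 0 i) 0.
    rewrite a0 normr0 mulr0 -(raddf0 (dot a)); apply: ab.
    apply: hypercube_sub_dilate_rho => //; apply/hypercube_norm => j.
    by rewrite mxE normr0.
  have := ab _ (dilate_rho_delta k%:R i (_ : `|Num.sg (a 0 i)| = 1)).
  by rewrite normr_sg a0 dotZ dot_delta -mulrA -normrEsg; apply.
have ab' : \sum_i `|a 0 i| <= b.
  rewrite -dot_sgv; apply: ab; apply: hypercube_sub_dilate_rho => //.
  exact: hypercube_sgv.
(* If b were 0, the bounds would give a = 0 and the facet would be the whole polytope, of dimension
   d instead of d - 1. *)
have b0 : 0 < b.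
  have b_ge0 : 0 <= b by apply: le_trans ab'; apply: sumr_ge0.
  rewrite lt0r b_ge0 andbT; apply/eqP => b0.
  have a0 : a = 0.
    apply/rowP => i; rewrite mxE; apply/eqP; rewrite -normr_le0.
    by have := ak i; rewrite b0 pmulr_rle0.
  have PK : P = krho.
    rewrite PE; apply/seteqP; split => [x []//|x rx]; split => //=.
    by rewrite a0 b0 dotC (raddf0 (dot x)).
  have := has_dim_uniq Pd; rewrite PK => /(_ _ has_dim_dilate_rho).
  by lia.
(* This scaling turns the bounds k |a_i| <= b and sum |a_i| <= b into |c_i| <= 1 and sum |c_i| <=
   k. *)
pose c := (k%:R / b) *: a.
have kb0 : 0 < k%:R / b by rewrite divr_gt0.
have cE i : `|c 0 i| = k%:R / b * `|a 0 i| by rewrite mxE normrM gtr0_norm.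
have dc x : dot c x = k%:R / b * dot a x by rewrite dotC dotZ dotC.
have c1 i : `|c 0 i| <= 1 by rewrite cE mulrAC ler_pdivrMr// mul1r.
have ck : \sum_i `|c 0 i| <= k%:R.
  under eq_bigr do rewrite cE.
  by rewrite -mulr_sumr mulrAC ler_pdivrMr// ler_pM2l.
have PcE : P = krho `&` [set x | dot c x = k%:R].
  rewrite PE; congr (_ `&` _); apply/seteqP; split=> x /=; rewrite dc.
    by move=> ->; rewrite divfK// lt0r_neq0.
  move=> e; apply: (mulfI (lt0r_neq0 kb0)).
  by rewrite e divfK// lt0r_neq0.
have Pc x : P x -> dot c x = k%:R by rewrite PcE => -[].
have c_ext : extreme_normal c.
  move=> e ce; suff : c = c + e by rewrite -{1}[c]addr0 => /addrI.
  have dot_ce s x : dot (c + s *: e) x = dot c x + s * dot e x.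
    by rewrite dotC dotD dotZ !(dotC x).
  (* On the facet, c + e and c - e are both at most k while their average c equals k, so c + e
     equals k there too and is a second normal at the same level. *)
  apply: (hyperplane_normal_uniq d0 Pd kR_neq0) => // x Px.
  have ce_le (s : R) : `|s| = 1 -> dot (c + s *: e) x <= k%:R.
    move=> /ce[ce1 cek]; apply: dot_dilate_rho_le => [i||].
    - by rewrite mxE [X in _ + X]mxE; exact: ce1.
    - by under eq_bigr do rewrite mxE [X in _ + X]mxE.
    - by move: Px; rewrite PE => -[].
  have := ce_le 1 (normr1 _); have := ce_le (-1) (normrN1 _).
  by rewrite !dot_ce -[e in dot (c + e)]scale1r dot_ce (Pc _ Px); lra.
have cc := extreme_normal_sgv c1 ck c_ext.
have cs := card_supp_extreme_normal c1 ck c_ext.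
by exists c; rewrite pulled_facetE.
Qed.

End PulledFacets.

(** * Correspondence between cube faces and facets of the dilated polytope *)

Unset Implicit Arguments.

Theorem theorem2p1 (R : realType) (d k : nat)
    (d_ge1 : (1 <= d)%N) (k_ge1 : (1 <= k)%N) (k_le_d : (k <= d)%N) :
  (forall G : set 'rV[R]_d,
     is_face (hypercube R d) G -> has_dim G (d - k) ->
     (cube_facets_containing G #= `I_k)%card /\
     is_regular_simplex (k - 1) (pulled_points k%:R G)
                                (pulled_simplex k%:R G)) /\
  (forall P : set 'rV[R]_d,
     is_facet (dilate k%:R (rho d k%:R)) P <->
     exists G : set 'rV[R]_d,
       [/\ is_face (hypercube R d) G, has_dim G (d - k)
         & P = cvx_hull (G `|` pulled_simplex k%:R G)]).
Proof.
split=> [G fG dG|P].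
  have [u [uu uk ->]] := (cube_faceP G k_le_d).1 (conj fG dG).
  rewrite -uk; split; first exact: card_cube_facets_containing.
  by apply: pulled_simplex_regular; rewrite ?uk// pnatr_eq0 -lt0n.
split=> [/(facet_dilate_rhoP d_ge1 k_ge1 k_le_d)[u [uu uk ->]]|[G [fG dG ->]]].
  have [fG dG] := (cube_faceP (cface u) k_le_d).2
    (ex_intro _ u (And3 uu uk erefl)).
  by exists (cface u).
have [u [uu uk ->]] := (cube_faceP G k_le_d).1 (conj fG dG).
exact: is_facet_pulled_facet.
Qed.
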